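(* Let $D\subseteq A$ be asset groups, with discounted price vectors $S^A=(S^i)_{i\in A}$ and $S^D=(S^i)_{i\in D}$. If $(\mathbb G,\mathbb Q)$ is an admissible pricing structure for $S^A$, then $\mathbb G$ is information-admissible for $S^D$ and $S^D$ is a $(\mathbb Q,\mathbb G)$-local martingale; if $S^D$ is locally bounded, it is a $(\mathbb Q,\mathbb F^{S^D})$-local martingale, where $\mathbb F^{S^D}$ is the natural filtration of $S^D$. If both $S^A$ and $S^D$ are $(\mathbb Q,\mathbb G)$-local martingales under a common pair $(\mathbb G,\mathbb Q)$, then $S^{A\cup D}=(S^i)_{i\in A\cup D}$ is a $(\mathbb Q,\mathbb G)$-local martingale.
   Context: The probability space $(\Omega,\mathcal F,\mathbb P)$ carries a finite-dimensional Brownian motion $W$, and the reference filtration $\mathbb F^W$ is the usual augmentation of its natural filtration. All processes and filtrations live on a finite horizon $[0,T]$; all filtrations (including natural price filtrations) satisfy the usual conditions; equalities of $\sigma$-fields are up to $\mathbb P$-null sets. A discounted asset group $S^A=(S^i)_{i\in A}$ is a vector semimartingale, and the local martingale property is understood componentwise. Information admissibility: an enlargement $\mathbb F^W\subseteq\mathbb G$ under the usual conditions is information-admissible if immersion holds, i.e. every $(\mathbb P,\mathbb F^W)$-local martingale is a $(\mathbb P,\mathbb G)$-local martingale (equivalently, $W$ remains a $(\mathbb P,\mathbb G)$-Brownian motion). This definition does not involve the asset group; ''information-admissible for $S^D$'' means that $\mathbb G$ is information-admissible in this sense. Admissible pricing structure for an asset group $A$ (or for $S^A$): a pair $(\mathbb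 G,\mathbb Q)$ with $\mathbb G$ information-admissible, $S^A$ a $\mathbb G$-semimartingale, $\mathbb Q$ a probability measure equivalent to $\mathbb P$, and $S^A$ a $(\mathbb Q,\mathbb G)$-local martingale. *)

(* Defs.v *)
From HB Require Import structures.
From mathcomp Require Export all_boot all_order all_algebra finmap.
From mathcomp Require Export all_classical all_reals all_analysis.
Export Order.TTheory GRing.Theory Num.Theory.
Export numFieldNormedType.Exports.
Set Implicit Arguments.
Unset Strict Implicit.
Unset Printing Implicit Defensive.
Local Open Scope classical_set_scope.
Local Open Scope ring_scope.

(* Processes and filtrations are indexed by all of R, but only the times in
   [0, T] are ever constrained or used. *)
Definition process (R : realType) (Omega : Type) := R -> Omega -> R.
Definition vprocess (R : realType) (Omega J : Type) := J -> process R Omega.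
Definition filtration (R : realType) (Omega : Type) := R -> set (set Omega).

Section processes.
Context {R : realType} {d : measure_display} {Omega : measurableType d}.
Implicit Types (mu P Q : probability Omega R) (T : R).
Implicit Types (F G : filtration R Omega) (X : process R Omega).

Definition measurable_wrt (H : set (set Omega)) (f : Omega -> R) :=
  forall B : set R, measurable B -> H (f @^-1` B).

(* All subsets of P-null events belong to G 0, so that a space carrying such a
   filtration is necessarily complete. *)
Record usual_filtration P T G : Prop := UsualFiltration {
  filtration_sigma : forall t, 0 <= t <= T -> sigma_algebra setT (G t) ;
  filtration_sub : forall t, 0 <= t <= T -> G t `<=` measurable ;
  filtration_mono : forall s t, 0 <= s -> s <= t -> t <= T -> G s `<=` G t ;
  filtration_complete : P.-negligible `<=` G 0 ;
  filtration_right : forall t, 0 <= t < T ->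
    \bigcap_(u in `]t, T]) G u `<=` G t }.

Definition past T (J : Type) (X : vprocess R Omega J) (t : R) :
    set (set Omega) :=
  [set E | exists j s B,
    [/\ 0 <= s <= Num.min t T, measurable B & E = X j s @^-1` B]].

(* Since past T X u is constant for u >= T, the intersection over u > t is the
   right limit when t < T, and adds nothing at the terminal time t = T. *)
Definition natural_filtration P T (J : Type) (X : vprocess R Omega J) :
    filtration R Omega :=
  fun t => \bigcap_(u in [set u | t < u])
    <<s past T X u `|` P.-negligible >>.

Definition adapted T G X := forall t, 0 <= t <= T -> measurable_wrt (G t) (X t).

Definition cadlag_path T (f : R -> R) :=
  (forall t, 0 <= t < T -> f u @[u --> t^'+] --> f t) /\
  (forall t, 0 < t <= T -> cvg (f u @[u --> t^'-])).

Definition cadlag mu T X := {ae mu, forall w, cadlag_path T (X ^~ w)}.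

Definition is_cond_exp mu (H : set (set Omega)) (f g : Omega -> R) :=
  [/\ measurable_wrt H g,
      mu.-integrable setT (EFin \o f), mu.-integrable setT (EFin \o g) &
      forall E, H E ->
        (\int[mu]_(w in E) (f w)%:E = \int[mu]_(w in E) (g w)%:E)%E].

Definition martingale mu T G X :=
  forall s t, 0 <= s -> s <= t -> t <= T -> is_cond_exp mu (G s) (X t) (X s).

Definition stopping_time T G (tau : Omega -> R) :=
  (forall w, 0 <= tau w <= T) /\
  (forall t, 0 <= t <= T -> G t [set w | tau w <= t]).

(* On the closed horizon [0, T] a localizing sequence must eventually be equal
   to T; mere convergence to T would only localize on [0, T[. *)
Definition localizing mu T G (tau : nat -> Omega -> R) :=
  (forall n, stopping_time T G (tau n)) /\
  {ae mu, forall w, (forall n, tau n w <= tau n.+1 w) /\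
                    (exists n, tau n w = T)}.

(* The initial value is subtracted because X 0 need be neither integrable nor
   bounded when the initial sigma-field is not trivial. *)
Definition stopped_increment X (tau : Omega -> R) : process R Omega :=
  fun t w => X (Num.min t (tau w)) w - X 0 w.

Definition local_martingale mu T G X :=
  [/\ adapted T G X, cadlag mu T X &
      exists tau, localizing mu T G tau /\
        forall n, martingale mu T G (stopped_increment X (tau n))].

Definition locally_bounded mu T G X :=
  exists tau, localizing mu T G tau /\
    forall n, exists K : R, {ae mu, forall w, forall t, 0 <= t <= T ->
      `|stopped_increment X (tau n) t w| <= K}.

Definition semimartingale P T G X :=
  adapted T G X /\
  exists M V : process R Omega,
    [/\ local_martingale P T G M,
        adapted T G V,
        cadlag P T V,
        {ae P, forall w, bounded_variation 0 T (V ^~ w)} &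
        {ae P, forall w, [/\ M 0 w = 0, V 0 w = 0 &
          forall t, 0 <= t <= T -> X t w = X 0 w + M t w + V t w]}].

Definition vlocal_martingale mu T G (J : Type) (X : vprocess R Omega J) :=
  forall j, local_martingale mu T G (X j).

Definition vlocally_bounded mu T G (J : Type) (X : vprocess R Omega J) :=
  forall j, locally_bounded mu T G (X j).

Definition vsemimartingale P T G (J : Type) (X : vprocess R Omega J) :=
  forall j, semimartingale P T G (X j).

Definition increment_in (n : nat) (W : vprocess R Omega 'I_n) (s t : R)
    (B : 'I_n -> set R) : set Omega :=
  [set w | forall i, B i (W i t w - W i s w)].

(* Measurable boxes form a pi-system generating the Borel sets of R^n, so
   brownian_indep is independence of W_t - W_s from sigma(W_u, u <= s) and
   brownian_gauss says that W_t - W_s has law N(0, (t - s) I_n). *)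
Record brownian_motion P T (n : nat) (W : vprocess R Omega 'I_n) : Prop :=
  BrownianMotion {
  brownian_meas : forall i t, 0 <= t <= T -> measurable_fun setT (W i t) ;
  brownian_start : {ae P, forall w, forall i, W i 0 w = 0} ;
  brownian_cont : {ae P, forall w, forall i,
    {within `[0, T], continuous (fun t => W i t w)}} ;
  brownian_indep : forall s t, 0 <= s -> s < t -> t <= T ->
    forall E B, <<s past T W s >> E -> (forall i, measurable (B i)) ->
    (P (E `&` increment_in W s t B) = P E * P (increment_in W s t B))%E ;
  brownian_gauss : forall s t, 0 <= s -> s < t -> t <= T ->
    forall B, (forall i, measurable (B i)) ->
    P (increment_in W s t B) =
      (\prod_(i < n) fine (normal_prob 0 (Num.sqrt (t - s)) (B i)))%:E }.

Record information_admissible P T (n : nat) (W : vprocess R Omega 'I_n) G :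
  Prop := InformationAdmissible {
  info_usual : usual_filtration P T G ;
  info_enlarges : forall t, 0 <= t <= T -> natural_filtration P T W t `<=` G t ;
  info_immersion : forall X, local_martingale P T (natural_filtration P T W) X ->
    local_martingale P T G X }.

Definition equivalent_measures P Q := P `<< Q /\ Q `<< P.

Record admissible_pricing_structure P T (n : nat) (W : vprocess R Omega 'I_n)
    (J : Type) (X : vprocess R Omega J) G Q : Prop := AdmissiblePricing {
  pricing_info : information_admissible P T W G ;
  pricing_semimartingale : vsemimartingale P T G X ;
  pricing_equivalent : equivalent_measures P Q ;
  pricing_local_martingale : vlocal_martingale Q T G X }.

End processes.

Definition asset_group (R : realType) (Omega : Type) (I : choiceType)
    (S : vprocess R Omega I) (A : {fset I}) : vprocess R Omega A :=
  fun a => S (fsval a).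
Arguments asset_group {R Omega I} S A a t w : rename.

(* Main.v *)
(** Restriction to fewer assets is componentwise, so the content is the passage
    from G to the smaller filtration F generated by the prices.  A localizing
    F-sequence [tau] that makes the stopped increments bounded consists of
    G-stopping times; hence, by optional stopping, the stopped increments
    satisfy the martingale identity on events of G, in particular on those of
    F.  Being F-adapted and bounded, they are F-martingales, so [tau] itself
    localizes in F.  Boundedness of the stopped process replaces uniform
    integrability: [tau] is approximated from above by grid-valued times
    [tau_k], and N_{tau_k} is truncated at a level above the bound of N_{tau},
    which becomes inactive as k grows. *)

Require Import Defs.
From mathcomp Require Import measurable_realfun lra.
Set Implicit Arguments.
Unset Strict Implicit.
Unset Printing Implicit Defensive.
Local Open Scope classical_set_scope.
Local Open Scope ring_scope.

(** * Right-continuous paths and approximation of times from above by grids *)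

Section right_continuity.
Context {R : realType}.
Implicit Types (T t x : R) (f : R -> R) (k : nat).

Definition right_continuous_path T f :=
  forall t, 0 <= t < T -> f u @[u --> t^'+] --> f t.

(* No left limit is needed at x = T: the sequence is then constant. *)
Lemma right_continuous_cvg T f x (r : nat -> R) :
    right_continuous_path T f -> 0 <= x -> (forall k, x <= r k <= T) ->
  r @ \oo --> x -> f (r k) @[k --> \oo] --> f x.
Proof.
move=> rcf x0 xrT rx.
have [xT|Tx] := ltP x T; last first.
  have -> : (fun k => f (r k)) = cst (f x).
    apply/funext => k; congr f; apply/eqP; rewrite eq_le.
    by have /andP[-> /le_trans ->] := xrT k.
  exact: cvg_cst.
have {}rcf : f u @[u --> x^'+] --> f x by apply: rcf; rewrite x0 xT.
apply/cvgrPdist_lt => e e0.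
have : \forall u \near x^'+, `|f x - f u| < e by exact: cvgr_dist_lt.
rewrite near_withinE => /nbhs_ballP[/= dl dl0 fdl].
have : \forall k \near \oo, `|x - r k| < dl by exact: cvgr_dist_lt.
apply: filterS => k xrk.
(* The right neighbourhood of [x] is punctured, so indices with [r k = x] are settled apart. *)
have /andP[+ _] := xrT k; rewrite le_eqVlt => /orP[/eqP <-|xrk'].
  by rewrite subrr normr0.
exact: fdl.
Qed.

Lemma right_continuous_stopped T f (c : R) :
  right_continuous_path T f ->
  right_continuous_path T (fun t => f (Num.min t c) - f 0).
Proof.
move=> rcf t tT; apply: cvgB; last exact: cvg_cst.
have [tc|ct] := ltP t c.
  apply: cvg_trans (rcf t tT); apply: near_eq_cvg.
  have : \forall u \near t^'+, u < c by exact: nbhs_right_lt.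
  by apply: filterS => u uc; rewrite (min_idPl (ltW uc)).
suff: f (Num.min x c) @[x --> t^'+] --> f c by [].
apply: cvg_near_cst.
have : \forall u \near t^'+, t < u by exact: nbhs_right_gt.
by apply: filterS => u tu; rewrite (min_idPr (le_trans ct (ltW tu))).
Qed.

(** For [x >= 0] this is the least [i] with [x <= i / (k+1)]; the absolute value only casts the
    ceiling to [nat]. *)
Definition grid_index k x : nat := `|Num.ceil (x * k.+1%:R)|%N.

(** The cap at [t] allows the martingale property to be applied between any grid time and [t]. *)
Definition grid k t (i : nat) : R := Num.min t (i%:R / k.+1%:R).

Lemma grid_index_le k x i :
  0 <= x -> (grid_index k x <= i)%N = (x <= i%:R / k.+1%:R).
Proof.
move=> x0; have c0 : 0 <= Num.ceil (x * k.+1%:R).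
  by rewrite ceil_ge0; apply: lt_le_trans (mulr_ge0 x0 _) => //; rewrite ltrN10.
rewrite ler_pdivlMr ?ltr0n// -[i%:R]/(i%:Z%:~R) -ceil_le_int.
by rewrite -lez_nat /grid_index gez0_abs.
Qed.

(** The guard matters at [i = 0]: there [i.-1] is again 0, and without the guard [x = 0] would have
    no index. *)
Lemma grid_index_eq k x i : 0 <= x ->
  (grid_index k x == i) = (x <= i%:R / k.+1%:R) &&
    ~~ ((0 < i)%N && (x <= i.-1%:R / k.+1%:R)).
Proof.
move=> x0; rewrite -!grid_index_le// eqn_leq; congr andb.
by case: i => //= i; rewrite -ltnNge.
Qed.

Lemma grid_le k t i : grid k t i <= t.
Proof. by rewrite ge_min lexx. Qed.

Lemma grid_ge0 k t i : 0 <= t -> 0 <= grid k t i.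
Proof. by move=> t0; rewrite le_min t0 divr_ge0. Qed.

Lemma grid_ge k t x : 0 <= x <= t -> x <= grid k t (grid_index k x).
Proof. by move=> /andP[x0 xt]; rewrite le_min xt -grid_index_le /=. Qed.

Lemma grid_le_addr k t x : 0 <= x -> grid k t (grid_index k x) <= x + k.+1%:R^-1.
Proof.
move=> x0; rewrite ge_min; apply/orP; right.
(* By minimality of the index [i.+1], the previous grid point [i / (k+1)] lies strictly below
   [x]. *)
case E : (grid_index k x) => [|i].
  by rewrite mul0r addr_ge0// invr_ge0.
rewrite -natr1 mulrDl mul1r lerD2r ltW// ltNge -grid_index_le// E.
by rewrite ltnn.
Qed.

Lemma grid_cvg t x : 0 <= x <= t ->
  grid k t (grid_index k x) @[k --> \oo] --> x.
Proof.
move=> /[dup] xt /andP[x0 _].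
apply: (@squeeze_cvgr _ _ _ _ (cst x) (fun k => x + harmonic k)).
- by apply: nearW => k; rewrite grid_ge//= grid_le_addr.
- exact: cvg_cst.
- rewrite -[X in _ --> X]addr0; apply: cvgD; first exact: cvg_cst.
  exact: cvg_harmonic.
Qed.

End right_continuity.

(** * Measurability with respect to a sub-sigma-field *)

Section measurable_wrt.
Context {R : realType} {d : measure_display} {Omega : measurableType d}.
Implicit Types (H : set (set Omega)) (f g : Omega -> R).

(** Viewing [H] as a measurable type makes the closure properties of [measurable_fun] available. *)
Lemma measurable_wrtE H f : sigma_algebra setT H ->
  measurable_wrt H f <-> measurable_fun setT (f : g_sigma_algebraType H -> R).
Proof.
move=> sH; split=> [mf _ B mB|mf B mB].
  by rewrite setTI (measurable_g_measurableTypeE sH); exact: mf.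
have := mf measurableT B mB.
by rewrite setTI (measurable_g_measurableTypeE sH).
Qed.

Lemma measurable_wrt_sub H H' f : H `<=` H' ->
  measurable_wrt H f -> measurable_wrt H' f.
Proof. by move=> HH' mf B mB; apply/HH'/mf. Qed.

Lemma measurable_wrtB H f g : sigma_algebra setT H ->
  measurable_wrt H f -> measurable_wrt H g -> measurable_wrt H (f \- g).
Proof.
move=> sH /(measurable_wrtE _ sH) mf /(measurable_wrtE _ sH) mg.
by apply/(measurable_wrtE _ sH); exact: measurable_funB.
Qed.

Lemma measurable_wrt_measurable_fun H f : H `<=` measurable ->
  measurable_wrt H f -> measurable_fun setT f.
Proof. by move=> Hm mf _ B mB; rewrite setTI; apply/Hm/mf. Qed.

(** Off the exceptional set [N] the function is a pointwise limit of [H]-measurable ones; every part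
    of a preimage inside [N] is negligible, hence in [H] by completeness. *)
Lemma measurable_wrt_ae_cvg (mu : measure Omega R) H (f_ : nat -> Omega -> R) f :
    sigma_algebra setT H -> mu.-negligible `<=` H ->
    (forall k, measurable_wrt H (f_ k)) ->
    {ae mu, forall w, f_ k w @[k --> \oo] --> f w} ->
  measurable_wrt H f.
Proof.
move=> sH nH mf cf.
pose N := [set w | ~ (f_ k w @[k --> \oo] --> f w)].
have mN : measurable (N : set (g_sigma_algebraType H)).
  by rewrite (measurable_g_measurableTypeE sH); exact: nH.
have mfN : @measurable_fun _ _ (g_sigma_algebraType H) R (~` N) f.
  apply: (@measurable_fun_cvg _ (g_sigma_algebraType H) R (~` N) f_ f).
    move=> k; apply: measurable_funTS.
    exact/measurable_wrtE.
  by move=> w; exact: contrapT.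
move=> B mB; rewrite -(measurable_g_measurableTypeE sH) -(setIT (_ @^-1` _)).
rewrite -(setUv N) setIUr; apply: measurableU.
  rewrite (measurable_g_measurableTypeE sH); apply: nH.
  by apply: negligibleS cf => w [].
rewrite setIC; apply: mfN => //; exact: measurableC.
Qed.

End measurable_wrt.

(** * Usual and natural filtrations, and processes sampled at stopping times *)

Section filtrations.
Context {R : realType} {d : measure_display} {Omega : measurableType d}.
Implicit Types (mu nu : probability Omega R) (T t : R).
Implicit Types (F G : filtration R Omega) (X : process R Omega).

Lemma null_dominates_negligible mu nu :
  nu `<< mu -> mu.-negligible `<=` nu.-negligible.
Proof.
move=> /null_content_dominatesP numu N [A [mA A0 NA]].
by exists A; split=> //; exact: numu.
Qed.

(** Completeness is the only clause that involves the measure, and [nu]-null sets are [mu]-null. *)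
Lemma usual_filtration_dominates mu nu T G :
  mu `<< nu -> usual_filtration mu T G -> usual_filtration nu T G.
Proof.
move=> munu [sG Gm homoG complG rightG]; split=> //.
by apply: subset_trans complG; exact: null_dominates_negligible.
Qed.

Lemma filtration_negligible mu T G t : usual_filtration mu T G ->
  0 <= t <= T -> mu.-negligible `<=` G t.
Proof.
move=> uG /andP[t0 tT]; apply: subset_trans (filtration_complete uG) _.
exact: (filtration_mono uG).
Qed.

Lemma natural_filtration_adapted mu T (J : Type) (X : vprocess R Omega J) j :
  adapted T (natural_filtration mu T X) (X j).
Proof.
move=> t /andP[t0 tT] B mB u /= tu; apply: sub_sigma_algebra; left.
by exists j, t, B; split=> //; rewrite t0 le_min (ltW tu).
Qed.

Lemma natural_filtration_sub mu T G (J : Type) (X : vprocess R Omega J) :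
    usual_filtration mu T G -> (forall j, adapted T G (X j)) ->
  forall t, 0 <= t <= T -> natural_filtration mu T X t `<=` G t.
Proof.
move=> uG aX.
(* Generators of the past at [u] involve times up to [Num.min u T] only, so a [v] below [u] is
   allowed once it reaches [T]. *)
have pastG u v : 0 <= v -> Num.min u T <= v -> v <= T ->
    <<s past T X u `|` mu.-negligible >> `<=` G v.
  move=> v0 uv vT; apply: smallest_sub.
    by apply: (filtration_sigma uG); rewrite v0.
  move=> E [[j [s [B [/andP[s0 su] mB ->]]]]|nE]; last first.
    by apply: (filtration_negligible uG) nE; rewrite v0.
  have sv := le_trans su uv.
  apply: (filtration_mono uG s0 sv vT).
  by apply: aX => //; rewrite s0 (le_trans sv).
(* At the terminal time any [u > t] sees nothing beyond [T], and [t + 1] serves; before it, right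
   continuity of [G] brings [u] down to [t]. *)
move=> t /andP[t0 tT] E EF; have [Tt|{}tT] := leP T t.
  apply: (pastG (t + 1)) => //; first by rewrite ge_min Tt orbT.
  by apply: EF => /=; rewrite ltrDl.
apply: (filtration_right uG); rewrite ?t0// => u /=.
rewrite in_itv/= => /andP[tu uT]; apply: (pastG u) => //.
- exact: le_trans (ltW tu).
- by rewrite ge_min lexx.
- exact: EF.
Qed.

Lemma natural_filtration_usual mu T G (J : Type) (X : vprocess R Omega J) :
    usual_filtration mu T G -> (forall j, adapted T G (X j)) ->
  usual_filtration mu T (natural_filtration mu T X).
Proof.
move=> uG aX; split.
- move=> t tT; apply: sigma_algebra_bigcap => u _.
  exact: smallest_sigma_algebra.
- move=> t tT; apply: subset_trans (filtration_sub uG tT).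
  exact: natural_filtration_sub.
- by move=> s t s0 st tT E EF u /= tu; apply: EF; exact: le_lt_trans tu.
- by move=> E nE u _; apply: sub_sigma_algebra; right.
- move=> t /andP[t0 tT] E EF u /= tu.
  (* The hypothesis on [E] concerns times up to [T], whereas [u] may exceed [T]; a time [v] strictly
     between [t] and [Num.min u T] links the two. *)
  have tm : t < Num.min u T by rewrite lt_min tu.
  pose v := (t + Num.min u T) / 2.
  have /andP[tv vm] : t < v < Num.min u T by rewrite /v !midf_lt.
  move: vm; rewrite lt_min => /andP[vu vT].
  by apply: EF vu => /=; rewrite in_itv/= tv ltW.
Qed.

(** For [c < t] the cap at [t] is invisible and the event is that of [tau <= c]; for [t <= c] it is
    the whole space. *)
Lemma stopping_time_le G T (tau : Omega -> R) t c :
    sigma_algebra setT (G t) -> stopping_time T G tau ->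
    0 <= t <= T -> 0 <= c ->
  G (Num.min t c) [set w | Num.min t (tau w) <= c].
Proof.
move=> sG [_ stau] /andP[t0 tT] c0; have [ct|tc] := ltP c t.
  have -> : [set w | Num.min t (tau w) <= c] = [set w | tau w <= c].
    by apply/seteqP; split=> w /=; rewrite ge_min leNgt ct.
  by apply: stau; rewrite c0 (le_trans (ltW ct)).
have -> : [set w | Num.min t (tau w) <= c] = setT.
  by apply/seteqP; split=> w //= _; rewrite ge_min tc.
rewrite -(measurable_g_measurableTypeE sG); exact: measurableT.
Qed.

(** This makes the discretized time a stopping time: the event is a difference of two events of the
    form treated in [stopping_time_le], the subtracted one being known already at the previous grid
    time. *)
Lemma stopping_time_grid mu G T (tau : Omega -> R) t k i :
    usual_filtration mu T G -> stopping_time T G tau -> 0 <= t <= T ->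
  G (grid k t i) [set w | grid_index k (Num.min t (tau w)) = i].
Proof.
move=> uG stau tT; have /andP[t0 tT'] := tT.
have c0 j : 0 <= j%:R / k.+1%:R :> R by rewrite divr_ge0.
have gT : 0 <= grid k t i <= T.
  by rewrite grid_ge0//= (le_trans (grid_le _ _ _)).
have m0 w : 0 <= Num.min t (tau w).
  by rewrite le_min t0; have /andP[] := stau.1 w.
have sG := filtration_sigma uG gT.
have sGt := filtration_sigma uG tT.
have -> : [set w | grid_index k (Num.min t (tau w)) = i] =
    [set w | Num.min t (tau w) <= i%:R / k.+1%:R] `\`
    (if (0 < i)%N then [set w | Num.min t (tau w) <= i.-1%:R / k.+1%:R]
     else set0).
  apply/seteqP; split=> w /=.
    move=> /eqP; rewrite grid_index_eq// => /andP[-> ni]; split=> //.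
    by case: (0 < i)%N ni => [/negP|_ []].
  move=> [wi ni]; apply/eqP; rewrite grid_index_eq// wi /=; apply/negP.
  by case: (0 < i)%N ni.
rewrite -(measurable_g_measurableTypeE sG); apply: measurableD.
  rewrite (measurable_g_measurableTypeE sG).
  exact: (stopping_time_le sGt stau tT (c0 i)).
case: ifPn => i0; last exact: measurable0.
rewrite (measurable_g_measurableTypeE sG).
apply: (@filtration_mono _ _ _ _ _ _ uG (grid k t i.-1)); last 1 first.
- exact: (stopping_time_le sGt stau tT (c0 i.-1)).
- exact: grid_ge0.
- by rewrite le_min grid_le/= ge_min ler_pM2r ?invr_gt0 ?ltr0n// ler_nat leq_pred orbT.
- by case/andP: gT.
Qed.

Lemma min_stopping_itv G T (tau : Omega -> R) t w :
  stopping_time T G tau -> 0 <= t -> 0 <= Num.min t (tau w) <= t.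
Proof.
by move=> [tau0T _] t0; rewrite le_min t0 ge_min lexx/= andbT;
  have /andP[] := tau0T w.
Qed.

(* The least multiple of 1/(k+1) above min t tau, capped at t. *)
Definition discretize k t (tau : Omega -> R) (w : Omega) : R :=
  grid k t (grid_index k (Num.min t (tau w))).

(** The preimage splits into countably many pieces according to the grid index; on each, [X] is
    taken at a deterministic time not after [t]. *)
Lemma discretize_measurable mu G T X (tau : Omega -> R) t k :
    usual_filtration mu T G -> adapted T G X ->
    stopping_time T G tau -> 0 <= t <= T ->
  measurable_wrt (G t) (fun w => X (discretize k t tau w) w).
Proof.
move=> uG aX stau tT B mB; have /andP[t0 tT'] := tT.
have sGt := filtration_sigma uG tT.
have -> : (fun w => X (discretize k t tau w) w) @^-1` B = \bigcup_i
    ([set w | grid_index k (Num.min t (tau w)) = i] `&`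
     X (grid k t i) @^-1` B).
  apply/seteqP; split=> [w XB|w [i _ [/= <-]//]].
  by exists (grid_index k (Num.min t (tau w))).
rewrite -(measurable_g_measurableTypeE sGt); apply: bigcup_measurable => i _.
have gT : 0 <= grid k t i <= T.
  by rewrite grid_ge0//= (le_trans (grid_le _ _ _)).
have Gsub : G (grid k t i) `<=` G t.
  by apply: (filtration_mono uG); rewrite ?grid_ge0 ?grid_le.
apply: measurableI; rewrite (measurable_g_measurableTypeE sGt); apply: Gsub.
  exact: (stopping_time_grid k i uG).
exact: aX.
Qed.

Lemma discretize_cvg G T f (tau : Omega -> R) t w :
    right_continuous_path T f -> stopping_time T G tau -> 0 <= t <= T ->
  f (discretize k t tau w) @[k --> \oo] --> f (Num.min t (tau w)).
Proof.
move=> rcf stau /andP[t0 tT]; have mt := min_stopping_itv w stau t0.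
apply: (right_continuous_cvg rcf); first by case/andP: mt.
- by move=> k; rewrite grid_ge//= (le_trans (grid_le _ _ _)).
- exact: grid_cvg.
Qed.

(** Right continuity makes the stopped value an almost sure limit of the discretized ones, and
    completeness of [G t] absorbs the exceptional set. *)
Lemma stopped_measurable mu G T X (tau : Omega -> R) t :
    usual_filtration mu T G -> adapted T G X ->
    {ae mu, forall w, right_continuous_path T (X ^~ w)} ->
    stopping_time T G tau -> 0 <= t <= T ->
  measurable_wrt (G t) (fun w => X (Num.min t (tau w)) w).
Proof.
move=> uG aX rcX stau tT.
apply: (measurable_wrt_ae_cvg (mu := mu)
  (f_ := fun k w => X (discretize k t tau w) w) (filtration_sigma uG tT)).
- exact: (filtration_negligible uG).
- by move=> k; exact: (discretize_measurable k uG aX stau tT).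
- by apply: filterS rcX => w rcw; exact: (discretize_cvg rcw stau tT).
Qed.

End filtrations.

(** * Limits of integrals and optional stopping at grid-valued times *)

Section optional_stopping.
Context {R : realType} {d : measure_display} {Omega : measurableType d}.
Implicit Types (mu : probability Omega R) (T s t K : R).
Implicit Types (G : filtration R Omega) (X N : process R Omega).

Lemma integral_ae_cvg mu (E : set Omega) (f_ : nat -> Omega -> R)
    (f g : Omega -> R) :
    measurable E -> (forall k, measurable_fun setT (f_ k)) ->
    measurable_fun setT f ->
    {ae mu, forall w, f_ k w @[k --> \oo] --> f w} ->
    mu.-integrable setT (EFin \o g) ->
    {ae mu, forall w, forall k, `|f_ k w| <= g w} ->
  (\int[mu]_(w in E) (f_ k w)%:E)%E @[k --> \oo] -->
  (\int[mu]_(w in E) (f w)%:E)%E.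
Proof.
move=> mE mf_ mf cf ig fg.
have [] := @dominated_convergence _ _ _ mu E mE (fun k => EFin \o f_ k)
  (EFin \o f) (EFin \o g) => //.
- by move=> k; apply/measurable_EFinP; exact: measurable_funTS.
- by apply/measurable_EFinP; exact: measurable_funTS.
- by apply: filterS cf => w cfw _; apply: cvg_EFin => //; exact: nearW.
- exact: integrableS ig.
- by apply: filterS fg => w fgw k _; rewrite /= lee_fin; exact: fgw.
Qed.

(** Moves a constraint that varies with [k] from the domain into the integrand, so that dominated
    convergence applies over a fixed [E]. *)
Lemma integral_setI_indicM mu (E C : set Omega) (f : Omega -> R) :
  (\int[mu]_(w in E `&` C) (f w)%:E = \int[mu]_(w in E) (f w * \1_C w)%:E)%E.
Proof.
rewrite integral_mkcondr; apply: eq_integral => w _.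
by rewrite patchE indicE; case: (w \in C); rewrite ?mulr1 ?mulr0.
Qed.

Lemma martingale_measurable mu T G N t : usual_filtration mu T G ->
  martingale mu T G N -> 0 <= t <= T -> measurable_fun setT (N t).
Proof.
move=> uG mN tT; have /andP[t0 tT'] := tT.
have [mNt _ _ _] := mN t t t0 (lexx t) tT'.
exact: measurable_wrt_measurable_fun (filtration_sub uG tT) mNt.
Qed.

Lemma martingale_integrable mu T G N t :
  martingale mu T G N -> 0 <= t <= T -> mu.-integrable setT (EFin \o N t).
Proof. by move=> mN /andP[t0 tT]; have [] := mN t t t0 (lexx t) tT. Qed.

Lemma martingale_adapted mu T G N : martingale mu T G N -> adapted T G N.
Proof. by move=> mN t /andP[t0 tT]; have [] := mN t t t0 (lexx t) tT. Qed.

(* On the piece of E `&` C where tau_k = u, the constraint C reads |N u| <= c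
   and is therefore an event of G u; truncating keeps N_{tau_k} integrable. *)
Lemma discrete_optional_stopping mu T G N tau s t c k (E : set Omega) :
    usual_filtration mu T G -> martingale mu T G N -> stopping_time T G tau ->
    0 <= s -> s <= t -> t <= T -> G s E -> E `<=` [set w | s <= tau w] ->
  let Nk := fun w => N (discretize k t tau w) w in
  let C := [set w | `|Nk w| <= c] in
  (\int[mu]_(w in E `&` C) (N t w)%:E = \int[mu]_(w in E `&` C) (Nk w)%:E)%E.
Proof.
move=> uG mN stau s0 st tT GE Etau Nk C.
have t0 := le_trans s0 st.
have t0T : 0 <= t <= T by rewrite t0.
have s0T : 0 <= s <= T by rewrite s0 (le_trans st).
have aN := martingale_adapted mN.
have mNk : measurable_fun setT Nk.
  apply: measurable_wrt_measurable_fun (filtration_sub uG t0T) _.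
  exact: discretize_measurable uG aN stau t0T.
have mE : measurable E by exact: (filtration_sub uG s0T).
have mC : measurable C.
  rewrite (_ : C = Nk @^-1` `[- c, c]); last first.
    by apply/seteqP; split=> w /=; rewrite /C in_itv/= ler_norml.
  by rewrite -[X in measurable X]setTI; exact: mNk.
pose A i := [set w | grid_index k (Num.min t (tau w)) = i].
pose F i := E `&` C `&` A i.
have gT i : 0 <= grid k t i <= T.
  by rewrite grid_ge0//= (le_trans (grid_le _ _ _)).
have mA i : measurable (A i).
  apply: (filtration_sub uG (gT i)).
  exact: (stopping_time_grid k i uG).
have mF i : measurable (F i) by do ![exact: mA|apply: measurableI].
have tF : trivIset setT F.
  by move=> i j _ _ [w [[_ <-] [_ <-]]].
have FE : E `&` C = \bigcup_i F i.
  apply/seteqP; split=> [w ECw|w [i _ [//]]].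
  by exists (grid_index k (Num.min t (tau w))).
have GF i : s <= grid k t i -> G (grid k t i) (F i).
  move=> si; have sG := filtration_sigma uG (gT i).
  have -> : F i = E `&` (N (grid k t i) @^-1` `[- c, c]) `&` A i.
    apply/seteqP; split=> w [[Ew Cw] Aw]; split=> //; split=> //; move: Cw.
      by rewrite /C /Nk /discretize /= Aw in_itv/= ler_norml.
    by rewrite /C /Nk /discretize /= Aw in_itv/= ler_norml.
  rewrite -(measurable_g_measurableTypeE sG).
  apply: measurableI; first apply: measurableI.
  - rewrite (measurable_g_measurableTypeE sG).
    by case/andP: (gT i) => _ iT; exact: (filtration_mono uG s0 si iT).
  - by rewrite (measurable_g_measurableTypeE sG); exact: aN.
  - rewrite (measurable_g_measurableTypeE sG).
    exact: (stopping_time_grid k i uG).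
(* Integrability, here from the truncation at [c], is what permits summing the integral over the
   countably many pieces. *)
have iNk : mu.-integrable (E `&` C) (EFin \o Nk).
  apply: measurable_bounded_integrable.
  - exact: measurableI.
  - by rewrite (le_lt_trans (probability_le1 _ _))// ?ltry//; exact: measurableI.
  - exact: measurable_funTS.
  - exists c; split=> [|M cM w [_ Cw]]; first exact: num_real.
    exact: le_trans Cw (ltW cM).
have iNt : mu.-integrable (E `&` C) (EFin \o N t).
  apply: (integrableS measurableT) => //; first exact: measurableI.
  exact: martingale_integrable mN t0T.
rewrite FE in iNk iNt *; rewrite !integral_bigcup//.
(* Pieces whose grid time precedes [s] are empty, since on [E] the discretized time is at least
   [Num.min t (tau w) >= s]; on the others the martingale identity from the grid time to [t]
   applies. *)
apply: eq_eseriesr => i _.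
have [si|is_] := leP s (grid k t i); last first.
  suff -> : F i = set0 by rewrite !integral_set0.
  apply/seteqP; split=> // w [[Ew _] Aw].
  suff : s <= grid k t i by rewrite leNgt is_.
  rewrite -Aw; apply: le_trans (grid_ge _ _).
    by rewrite le_min st; exact: Etau.
  exact: min_stopping_itv stau t0.
have /andP[i0 iT] := gT i.
have [_ _ _ ->] := mN _ _ i0 (grid_le k t i) tT; last exact: GF.
by apply: eq_integral => w /set_mem[_ Aw]; rewrite /Nk /discretize Aw.
Qed.

End optional_stopping.

(** * Optional stopping under a bound on the stopped process, and passage to a smaller filtration *)

Section bounded_stopping.
Context {R : realType} {d : measure_display} {Omega : measurableType d}.
Implicit Types (mu P Q : probability Omega R) (T s t K : R).
Implicit Types (F G : filtration R Omega) (X N : process R Omega).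

Lemma stopped_measurable_fun mu G T X tau t :
    usual_filtration mu T G -> adapted T G X ->
    {ae mu, forall w, right_continuous_path T (X ^~ w)} ->
    stopping_time T G tau -> 0 <= t <= T ->
  measurable_fun setT (fun w => X (Num.min t (tau w)) w).
Proof.
move=> uG aX rcX stau tT.
apply: measurable_wrt_measurable_fun (filtration_sub uG tT) _.
exact: stopped_measurable uG aX rcX stau tT.
Qed.

Lemma optional_stopping_after mu T G N tau s t K (E : set Omega) :
    usual_filtration mu T G -> martingale mu T G N ->
    {ae mu, forall w, right_continuous_path T (N ^~ w)} ->
    stopping_time T G tau ->
    {ae mu, forall w, `|N (Num.min t (tau w)) w| <= K} ->
    0 <= s -> s <= t -> t <= T -> G s E -> E `<=` [set w | s <= tau w] ->
  (\int[mu]_(w in E) (N t w)%:E =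
   \int[mu]_(w in E) (N (Num.min t (tau w)) w)%:E)%E.
Proof.
move=> uG mN rcN stau bN s0 st tT GE Etau.
have t0T : 0 <= t <= T by rewrite (le_trans s0 st).
have s0T : 0 <= s <= T by rewrite s0 (le_trans st).
have mE : measurable E by exact: (filtration_sub uG s0T).
pose Nk k w := N (discretize k t tau w) w.
(* The margin 1 makes the constraint hold for all large [k], as the limit is bounded by [K]; the
   absolute value keeps the level nonnegative, so that it also dominates outside [C k]. *)
pose C k := [set w | `|Nk k w| <= `|K| + 1].
have aN := martingale_adapted mN.
have mNt := martingale_measurable uG mN t0T.
have mNk k : measurable_fun setT (Nk k).
  apply: measurable_wrt_measurable_fun (filtration_sub uG t0T) _.
  exact: discretize_measurable uG aN stau t0T.
have mC k : measurable (C k).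
  rewrite (_ : C k = Nk k @^-1` `[- (`|K| + 1), `|K| + 1]); last first.
    by apply/seteqP; split=> w; rewrite /C /= in_itv/= ler_norml.
  by rewrite -[X in measurable X]setTI; exact: mNk.
have m1C k : measurable_fun setT (\1_(C k) : Omega -> R).
  exact: measurable_indic.
have CE : {ae mu, forall w, \forall k \near \oo, \1_(C k) w = 1 :> R}.
  apply: filterS2 rcN bN => w rcw bw.
  have : \forall k \near \oo, `|N (Num.min t (tau w)) w - Nk k w| < 1.
    by apply: (cvgr_dist_lt _ _ (discretize_cvg rcw stau t0T)).
  apply: filterS => k Nkw; rewrite indicE mem_set// /C /=.
  have := ler_norm K; have := ler_distD 0 (N (Num.min t (tau w)) w) (Nk k w).
  have := lerB_dist (Nk k w) (N (Num.min t (tau w)) w).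
  rewrite distrC => ? _ ?; lra.
(* The unstopped value [N t] has no bound; its own absolute value, integrable by the martingale
   property, dominates. *)
have cvgt : (\int[mu]_(w in E) (N t w * \1_(C k) w)%:E)%E @[k --> \oo] -->
    (\int[mu]_(w in E) (N t w)%:E)%E.
  apply: (integral_ae_cvg (g := fun w => `|N t w|)) => //.
  - by move=> k; exact: measurable_funM.
  - apply: filterS CE => w CEw; apply: cvg_near_cst.
    by apply: filterS CEw => k ->; rewrite mulr1.
  - apply: (@eq_integrable _ _ _ mu setT measurableT
      (abse \o (EFin \o N t))) => //.
    exact/integrable_abse/(martingale_integrable mN t0T).
  - apply: aeW => w k; rewrite normrM indicE.
    by case: (w \in C k); rewrite ?normr1 ?mulr1// normr0 mulr0.
have cvgtau : (\int[mu]_(w in E) (Nk k w * \1_(C k) w)%:E)%E @[k --> \oo] -->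
    (\int[mu]_(w in E) (N (Num.min t (tau w)) w)%:E)%E.
  apply: (integral_ae_cvg (g := cst (`|K| + 1))) => //.
  - by move=> k; exact: measurable_funM.
  - exact: stopped_measurable_fun uG aN rcN stau t0T.
  - apply: filterS2 CE rcN => w CEw rcw.
    apply: cvg_trans (discretize_cvg rcw stau t0T).
    apply: near_eq_cvg.
    by apply: filterS CEw => k ->; rewrite mulr1.
  - exact: finite_measure_integrable_cst.
  - apply: aeW => w k; rewrite normrM indicE /=.
    have [/set_mem wC|_] := boolP (w \in C k).
      by rewrite normr1 mulr1.
    by rewrite normr0 mulr0 addr_ge0.
suff eqk : (fun k => \int[mu]_(w in E) (N t w * \1_(C k) w)%:E)%E =
    (fun k => \int[mu]_(w in E) (Nk k w * \1_(C k) w)%:E)%E.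
  by rewrite eqk in cvgt; exact: cvg_unique cvgt cvgtau.
apply/funext => k; rewrite -!integral_setI_indicM.
exact: discrete_optional_stopping uG mN stau s0 st tT GE Etau.
Qed.

(** The event is split by [tau <= s]. Where this holds, both stopped values agree; elsewhere
    [optional_stopping_after] replaces the value at [Num.min t (tau w)] by [N t], the martingale
    property leads to [N s], and [s] is still before [tau]. *)
Lemma optional_stopping mu T G N tau s t K (E : set Omega) :
    usual_filtration mu T G -> martingale mu T G N ->
    {ae mu, forall w, right_continuous_path T (N ^~ w)} ->
    stopping_time T G tau ->
    {ae mu, forall w, `|N (Num.min t (tau w)) w| <= K} ->
    0 <= s -> s <= t -> t <= T -> G s E ->
  (\int[mu]_(w in E) (N (Num.min t (tau w)) w)%:E =
   \int[mu]_(w in E) (N (Num.min s (tau w)) w)%:E)%E.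
Proof.
move=> uG mN rcN stau bN s0 st tT GE.
have t0T : 0 <= t <= T by rewrite (le_trans s0 st).
have s0T : 0 <= s <= T by rewrite s0 (le_trans st).
have aN := martingale_adapted mN.
have sG := filtration_sigma uG s0T.
pose A := [set w | tau w <= s].
have GA : G s A by exact: stau.2.
have GEA : G s (E `\` A).
  by move: GE GA; rewrite -(measurable_g_measurableTypeE sG); exact: measurableD.
have mE := filtration_sub uG s0T GE.
have mA := filtration_sub uG s0T GA.
have mEA := filtration_sub uG s0T GEA.
have mst r : 0 <= r <= T ->
    measurable_fun setT (EFin \o (fun w => N (Num.min r (tau w)) w)).
  move=> r0T; apply/measurable_EFinP.
  exact: stopped_measurable_fun uG aN rcN stau r0T.
have disj : [disjoint E `&` A & E `\` A].
  by apply/disj_set2P; apply/seteqP; split=> w // [[_ Aw] [_ /(_ Aw)]].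
rewrite -(setUIDK E A) !integral_setU//; first last.
- exact: measurable_funTS (mst t t0T).
- exact: measurableI.
- exact: measurable_funTS (mst s s0T).
- exact: measurableI.
congr (_ + _)%E.
  apply: eq_integral => w /set_mem[_ Aw].
  by rewrite (min_idPr (le_trans Aw st)) (min_idPr Aw).
rewrite -(optional_stopping_after uG mN rcN stau bN s0 st tT GEA); last first.
  by move=> w [_ /negP]; rewrite -ltNge => /ltW.
have [_ _ _ ->//] := mN s t s0 st tT.
apply: eq_integral => w /set_mem[_ /negP]; rewrite -ltNge => /ltW sw.
by rewrite (min_idPl sw).
Qed.

Lemma cadlag_right_continuous mu T X : cadlag mu T X ->
  {ae mu, forall w, right_continuous_path T (X ^~ w)}.
Proof. by apply: filterS => w []. Qed.

(** A nondecreasing sequence bounded by [T] stays at [T] once it has reached it. *)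
Lemma localizing_eventually mu T G sigma : localizing mu T G sigma ->
  {ae mu, forall w, \forall m \near \oo, sigma m w = T}.
Proof.
move=> [ssigma]; apply: filterS => w [incr [m0 m0T]]; exists m0 => // m /= m0m.
have /andP[_ mT] := (ssigma m).1 w.
apply/eqP; rewrite eq_le mT/= -{1}m0T.
exact: (homo_leq lexx le_trans (f := fun m => sigma m w)).
Qed.

(** The sequence [sigma] gives martingales, [tau] gives the bound. Optional stopping at [tau] is
    applied to each process stopped at [sigma m], and [m] tends to infinity by dominated
    convergence. *)
Lemma bounded_stopped_local_martingale mu T G X tau s t K (E : set Omega) :
    usual_filtration mu T G -> local_martingale mu T G X ->
    stopping_time T G tau ->
    {ae mu, forall w, forall r, 0 <= r <= T ->
      `|stopped_increment X tau r w| <= K} ->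
    0 <= s -> s <= t -> t <= T -> G s E ->
  (\int[mu]_(w in E) (stopped_increment X tau t w)%:E =
   \int[mu]_(w in E) (stopped_increment X tau s w)%:E)%E.
Proof.
move=> uG [aX cX [sigma [lsigma msigma]]] stau bX s0 st tT GE.
have rcX := cadlag_right_continuous cX.
have t0T : 0 <= t <= T by rewrite (le_trans s0 st).
have s0T : 0 <= s <= T by rewrite s0 (le_trans st).
have mE := filtration_sub uG s0T GE.
pose N m := stopped_increment X (sigma m).
have rcN m : {ae mu, forall w, right_continuous_path T (N m ^~ w)}.
  apply: filterS rcX => w rcw.
  exact: (right_continuous_stopped (c := sigma m w) rcw).
(* Exchanging the order of the two stoppings shows that the bound [K] is uniform in [m]. *)
have NE m r w : N m (Num.min r (tau w)) w =
    stopped_increment X tau (Num.min r (sigma m w)) w.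
  by rewrite /N /stopped_increment minAC.
have bN m r : 0 <= r <= T ->
    {ae mu, forall w, `|N m (Num.min r (tau w)) w| <= K}.
  move=> /andP[r0 rT]; apply: filterS bX => w bw; rewrite NE; apply: bw.
  have /andP[-> /le_trans ->] := min_stopping_itv w (lsigma.1 m) r0 => //.
have mX0 : measurable_fun setT (X 0).
  have T0 : (0 : R) <= 0 <= T by rewrite lexx (le_trans s0)// (le_trans st).
  exact: measurable_wrt_measurable_fun (filtration_sub uG T0) (aX _ T0).
have cvgN r : 0 <= r <= T ->
    (\int[mu]_(w in E) (N m (Num.min r (tau w)) w)%:E)%E @[m --> \oo] -->
    (\int[mu]_(w in E) (stopped_increment X tau r w)%:E)%E.
  move=> r0T; apply: (integral_ae_cvg (g := cst K)) => //.
  - move=> m.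
    exact: stopped_measurable_fun uG (martingale_adapted (msigma m)) (rcN m)
      stau r0T.
  - apply: measurable_funB => //.
    exact: stopped_measurable_fun uG aX rcX stau r0T.
  - apply: filterS (localizing_eventually lsigma) => w mT.
    apply: cvg_near_cst; apply: filterS mT => m mT; rewrite NE mT.
    by case/andP: r0T => _ /min_idPl ->.
  - exact: finite_measure_integrable_cst.
  - by apply/ae_foralln => m; exact: bN.
have eqN : (fun m => \int[mu]_(w in E) (N m (Num.min t (tau w)) w)%:E)%E =
    (fun m => \int[mu]_(w in E) (N m (Num.min s (tau w)) w)%:E)%E.
  apply/funext => m.
  exact: optional_stopping uG (msigma m) (rcN m) stau (bN m t t0T) s0 st tT GE.
have := cvgN t t0T; rewrite eqN => ct.
exact: cvg_unique ct (cvgN s s0T).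
Qed.

(** Dominated convergence for a constant sequence turns an almost sure bound into integrability. *)
Lemma ae_bounded_integrable mu (f : Omega -> R) K : measurable_fun setT f ->
  {ae mu, forall w, `|f w| <= K} -> mu.-integrable setT (EFin \o f).
Proof.
move=> mf fK; have mEf : measurable_fun setT (EFin \o f) by exact/measurable_EFinP.
have [] // := @dominated_convergence _ _ _ mu setT measurableT
  (fun=> EFin \o f) (EFin \o f) (EFin \o cst K).
- by apply: aeW => w _; exact: cvg_cst.
- exact: finite_measure_integrable_cst.
- by apply: filterS fK => w fwK _ _; rewrite /= lee_fin.
Qed.

(** The localizing sequence has to come from local boundedness in [F]: one that localizes in [G]
    need not consist of [F]-stopping times. *)
Lemma local_martingale_shrink mu T F G X :
    usual_filtration mu T F -> usual_filtration mu T G ->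
    (forall t, 0 <= t <= T -> F t `<=` G t) ->
    adapted T F X -> locally_bounded mu T F X ->
  local_martingale mu T G X -> local_martingale mu T F X.
Proof.
move=> uF uG FG aX [tau [ltau btau]] lX; have [_ cX _] := lX.
split=> //; exists tau; split=> // n; have [K bK] := btau n.
have rcX := cadlag_right_continuous cX.
have stau := ltau.1 n.
have mX t : 0 <= t <= T ->
    measurable_wrt (F t) (stopped_increment X (tau n) t).
  move=> t0T; apply: measurable_wrtB; first exact: (filtration_sigma uF t0T).
    exact: stopped_measurable uF aX rcX stau t0T.
  have /andP[t0 tT] := t0T.
  apply: measurable_wrt_sub (filtration_mono uF (lexx 0) t0 tT) _.
  by apply: aX; rewrite lexx (le_trans t0).
have iX t : 0 <= t <= T ->
    mu.-integrable setT (EFin \o stopped_increment X (tau n) t).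
  move=> t0T.
  apply: (ae_bounded_integrable (K := K)).
    exact: measurable_wrt_measurable_fun (filtration_sub uF t0T) (mX t t0T).
  by apply: filterS bK => w bw; exact: bw.
move=> s t s0 st tT.
have t0T : 0 <= t <= T by rewrite (le_trans s0 st).
have s0T : 0 <= s <= T by rewrite s0 (le_trans st).
split; [exact: mX|exact: iX|exact: iX|move=> E FE].
apply: bounded_stopped_local_martingale uG lX _ bK s0 st tT (FG _ s0T _ FE).
by split=> [|r r0T]; [exact: stau.1|apply: FG => //; exact: stau.2].
Qed.

Lemma locally_bounded_dominates P Q T F X : Q `<< P ->
  locally_bounded P T F X -> locally_bounded Q T F X.
Proof.
move=> QP [tau [[stau ltau] btau]].
have aeQ := null_dominates_negligible QP.
exists tau; split; first by split=> //; exact: aeQ ltau.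
by move=> n; have [K bK] := btau n; exists K; exact: aeQ bK.
Qed.

End bounded_stopping.

Theorem proposition3p2 (R : realType) (d : measure_display)
    (Omega : measurableType d) (P : probability Omega R)
    (T : R) (hT : 0 < T)
    (n : nat) (W : vprocess R Omega 'I_n) (hW : brownian_motion P T W)
    (I : choiceType) (S : vprocess R Omega I) (A D : {fset I}) :
  ((D `<=` A)%fset ->
    forall (G : filtration R Omega) (Q : probability Omega R),
      admissible_pricing_structure P T W (asset_group S A) G Q ->
      [/\ information_admissible P T W G,
          vlocal_martingale Q T G (asset_group S D) &
          let FSD := natural_filtration P T (asset_group S D) in
          vlocally_bounded P T FSD (asset_group S D) ->
          vlocal_martingale Q T FSD (asset_group S D)])
  /\
  (forall (G : filtration R Omega) (Q : probability Omega R),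
      usual_filtration P T G ->
      equivalent_measures P Q ->
      vlocal_martingale Q T G (asset_group S A) ->
      vlocal_martingale Q T G (asset_group S D) ->
      vlocal_martingale Q T G (asset_group S (A `|` D)%fset)).
Proof.
split.
  move=> /fsubsetP DA G Q [iG _ [PQ QP] lmA].
  (* An asset of [D] is re-indexed as a member of [A]; the price depends only on the underlying
     value of the index. *)
  have lmD : vlocal_martingale Q T G (asset_group S D).
    by move=> j; exact: (lmA [` DA _ (fsvalP j)]%fset).
  split=> //= lb j.
  have uG := info_usual iG.
  have aD i : adapted T G (asset_group S D i) by have [] := lmD i.
  have uF := natural_filtration_usual uG aD.
  (* Completion and local boundedness are stated under [P], the martingale property under [Q]. The
     usual conditions transfer by [PQ], the almost sure bounds by [QP]. *)
  apply: (local_martingale_shrink (G := G)).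
  - exact: usual_filtration_dominates uF.
  - exact: usual_filtration_dominates uG.
  - exact: natural_filtration_sub.
  - exact: natural_filtration_adapted.
  - exact: locally_bounded_dominates (lb j).
  - exact: lmD.
move=> G Q _ _ lmA lmD j.
have /fsetUP[jA|jD] := fsvalP j.
  exact: (lmA [` jA]%fset).
exact: (lmD [` jD]%fset).
Qed.
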